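(* Let $\mathcal{O}$ be a Dedekind domain and let $\mathcal{F}$ be a finite set of maximal ideals in $\mathcal{O}$. Let $M_i$, $1\leq i\leq l$, be finitely many co-torsion submodules of rank two in $\mathcal{O}^2$ with invariant factor ideals $\mathcal{L}_i \supseteq \mathcal{K}_i$ such that $\mathcal{K}_i+\mathcal{K}_j=\mathcal{O}$ for $1\leq i\neq j\leq l$. Let $\mathcal{I}_i$, $1\leq i\leq l$, be the ideals in $\mathcal{O}$ with $\mathcal{K}_i=\mathcal{L}_i\mathcal{I}_i$. Assume that if a maximal ideal $\mathcal{M}$ satisfies $\mathcal{M} \supseteq \mathcal{K}_i$ for some $1\leq i\leq l$, then $\mathcal{M}\in \mathcal{F}$. For $1\leq i\leq l$, let $[a_i:b_i]\in \mathbb{PF}^1_{\mathcal{I}_i}$ be the projective space invariant element of $M_i$. Let $a,b\in \mathcal{O}$ with $\langle a \rangle +\langle b \rangle=\mathcal{O}$, defining $[a:b]\in \mathbb{PF}^1_{\prod_{i=1}^l\mathcal{I}_i}$, be such that $[a:b]=[a_i:b_i]\in \mathbb{PF}^1_{\mathcal{I}_i}$ for $1\leq i\leq l$. Then: \begin{enumerate} \item The module $\bigcap_{i=1}^{l} M_i$ is a co-torsion module of rank two in $\mathcal{O}^2$. \item The invariant factor ideals of $\bigcap_{i=1}^{l} M_i$ are $\mathcal{L}=\prod_{i=1}^l\mathcal{L}_i\supseteq \mathcal{K}=\prod_{i=1}^l\mathcal{K}_i$. \item The projective space invariant element of $\bigcap_{i=1}^{l} M_i$ is $[a:b]\in \mathbb{PF}^1_{\prod_{i=1}^l\mathcal{I}_i}$.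 \item For any element $t\in \mathcal{L}\setminus\big(\bigcup_{\mathcal{M}\in \mathcal{F}}\mathcal{L}\mathcal{M}\big)$ we have $(ta,tb)\in \bigcap_{i=1}^{l} M_i$. \end{enumerate}
   Context: An $\mathcal{O}$-submodule $M\subseteq \mathcal{O}^2$ is co-torsion if $\mathcal{O}^2/M$ is a torsion $\mathcal{O}$-module. Its rank is the cardinality of a maximal $\mathcal{O}$-linearly independent subset. Projective space: let $(\mathcal{O}^2)^{*}=\{(a,b)\in \mathcal{O}^2\mid \langle a\rangle +\langle b\rangle = \mathcal{O}\}$. For an ideal $\mathcal{I}\subseteq\mathcal{O}$, define the equivalence relation on $(\mathcal{O}^2)^*$ by $(a,b)\sim (c,d)$ iff $ad-bc\in \mathcal{I}$. Then $\mathbb{PF}^1_{\mathcal{I}}=(\mathcal{O}^2)^{*}/\sim$, and the class of $(a,b)$ is denoted $[a:b]$. Invariants of a co-torsion submodule $M\subseteq\mathcal{O}^2$: there are finitely many distinct maximal ideals $\mathcal{M}_1,\dots,\mathcal{M}_r$ of $\mathcal{O}$ and integers $0\le n_j\le k_j\ne 0$, $1\le j\le r$, with $\mathcal{O}^2/M\cong\bigoplus_{j=1}^r\big(\mathcal{O}/\mathcal{M}_j^{n_j}\oplus\mathcal{O}/\mathcal{M}_j^{k_j}\big)$ ($r=0$ if $M=\mathcal{O}^2$). The invariant factor ideals of $M$ are $\mathcal{L}=\prod_{j=1}^r\mathcal{M}_j^{n_j}\supseteq\mathcal{K}=\prod_{j=1}^r\mathcal{M}_j^{k_j}$, so $\mathcal{O}^2/M\cong\mathcal{O}/\mathcal{L}\oplus\mathcal{O}/\mathcal{K}$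 (empty products are $\mathcal{O}$). Put $\mathcal{I}=\prod_{j=1}^r\mathcal{M}_j^{k_j-n_j}$, so $\mathcal{K}=\mathcal{L}\mathcal{I}$. The projective space invariant element of $M$ is the class $[a:b]\in\mathbb{PF}^1_{\mathcal{I}}$ of any $(a,b)\in(\mathcal{O}^2)^*$ for which there is $t\in\mathcal{L}\setminus\bigcup_{j=1}^r\mathcal{L}\mathcal{M}_j$ with $(ta,tb)\in M$; such a pair exists and its class in $\mathbb{PF}^1_{\mathcal{I}}$ depends only on $M$ (if $M=\mathcal{O}^2$ it is the single element of $\mathbb{PF}^1_{\mathcal{O}}$). *)

(* Defs.v *)
From HB Require Import structures.
From mathcomp Require Import all_boot all_order all_algebra.
From mathcomp Require Import generic_quotient fraction ring_quotient ring.
From mathcomp Require Import boolp classical_sets functions cardinality.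

Set Implicit Arguments.
Unset Strict Implicit.
Unset Printing Implicit Defensive.

Import GRing.Theory.
Local Open Scope ring_scope.
Local Open Scope classical_set_scope.
Local Open Scope quotient_scope.
Local Open Scope card_scope.

(* Submodules are bundled Prop-valued sets, so that arbitrary (not necessarily
   decidable) submodules and ideals are covered. *)
Section Submodules.
Variables (R : comNzRingType) (V : lmodType R).

Definition is_submodule (N : set V) : Prop :=
  N 0 /\ forall (r : R) (u v : V), N u -> N v -> N (r *: u + v).

Record submodule := Submodule {
  submodule_set :> set V;
  submoduleP : is_submodule submodule_set }.

Definition in_submodule (N : submodule) : V -> Prop := submodule_set N.
Coercion in_submodule : submodule >-> Funclass.

Lemma submodule_ext (M N : submodule) : M = N :> set V -> M = N.
Proof.
case: M N => [M hM] [N hN] /= eMN; move: hM hN; rewrite eMN => hM hN.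
by congr Submodule; exact: Prop_irrelevance.
Qed.

Lemma is_submodule_setT : is_submodule setT. Proof. by []. Qed.
Definition submodule_full := Submodule is_submodule_setT.

Lemma is_submodule_span (S : set V) : is_submodule (smallest is_submodule S).
Proof.
split=> [N [[]]//|r u v uS vS N [hN SN]].
by apply: hN.2; [exact: uS|exact: vS].
Qed.
Definition span (S : set V) := Submodule (is_submodule_span S).

Lemma is_submodule_bigcap (T : Type) (M : T -> submodule) :
  is_submodule (\bigcap_i M i).
Proof.
split=> [i _|r u v uM vM i _]; first exact: (submoduleP (M i)).1.
by apply: (submoduleP (M i)).2; [exact: uM|exact: vM].
Qed.
Definition submodule_bigcap (T : Type) (M : T -> submodule) :=
  Submodule (is_submodule_bigcap M).

Definition linearly_independent (S : set V) : Prop :=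
  forall (s : seq V) (c : V -> R), uniq s -> (forall v, v \in s -> S v) ->
    \sum_(v <- s) c v *: v = 0 -> forall v, v \in s -> c v = 0.

Definition maximal_independent (N S : set V) : Prop :=
  [/\ S `<=` N, linearly_independent S &
      forall T : set V, T `<=` N -> linearly_independent T -> S `<=` T ->
        T = S].

Definition has_rank (N : set V) (n : nat) : Prop :=
  exists2 S : set V, maximal_independent N S & S #= `I_n.

Definition is_torsion : Prop :=
  forall v : V, exists2 r : R, r != 0 & r *: v = 0.

End Submodules.

(* The library's quotient [Quotient.quot] is only a zmodType; it is given the
   induced R-module structure. *)
Section QuotientModule.
Variables (R : comNzRingType) (V : lmodType R) (N : submodule V).

Definition submodule_pred : {pred V} := fun v => `[< N v >].

Lemma submodule_pred_closed : zmod_closed submodule_pred.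
Proof.
have [N0 NL] := submoduleP N.
split=> [|u v /asboolP Nu /asboolP Nv]; apply/asboolP => //.
rewrite addrC -scaleN1r; exact: NL.
Qed.
HB.instance Definition _ :=
  GRing.isZmodClosed.Build V submodule_pred submodule_pred_closed.

Definition quotient_module : Type := Quotient.quot submodule_pred.
HB.instance Definition _ := GRing.Zmodule.on quotient_module.

Definition quotient_class (v : V) : quotient_module :=
  \pi_(Quotient.quot submodule_pred) v.
Definition quotient_repr (x : quotient_module) : V :=
  repr (x : Quotient.quot submodule_pred).

Lemma quotient_reprK x : quotient_class (quotient_repr x) = x.
Proof. exact: reprK. Qed.

Lemma quotient_classP u v : quotient_class u = quotient_class v <-> N (u - v).
Proof.
split=> [/eqP|h].
  by rewrite /quotient_class -Quotient.idealrBE => /asboolP.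
by apply/eqP; rewrite /quotient_class -Quotient.idealrBE; apply/asboolP.
Qed.

Lemma quotient_classD u v :
  quotient_class (u + v) = quotient_class u + quotient_class v.
Proof. exact: (raddfD (\pi_(Quotient.quot submodule_pred))). Qed.

Definition quotient_scale (r : R) (x : quotient_module) : quotient_module :=
  quotient_class (r *: quotient_repr x).

Lemma quotient_classZ r v :
  quotient_class (r *: v) = quotient_scale r (quotient_class v).
Proof.
apply/quotient_classP; rewrite -scalerBr -[_ *: _]addr0.
have [N0 NL] := submoduleP N; apply: NL => //.
by apply/quotient_classP; rewrite quotient_reprK.
Qed.

Lemma quotient_scaleA a b x :
  quotient_scale a (quotient_scale b x) = quotient_scale (a * b) x.
Proof.
by rewrite -[x]quotient_reprK -!quotient_classZ scalerA.
Qed.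
Lemma quotient_scale1 : left_id 1 quotient_scale.
Proof.
by move=> x; rewrite -[x]quotient_reprK -!quotient_classZ scale1r.
Qed.
Lemma quotient_scaleDr : right_distributive quotient_scale +%R.
Proof.
move=> a x y; rewrite -[x]quotient_reprK -[y]quotient_reprK.
by rewrite -quotient_classD -!quotient_classZ -quotient_classD scalerDr.
Qed.
Lemma quotient_scaleDl x : {morph quotient_scale^~ x : a b / a + b}.
Proof.
move=> a b; rewrite -[x]quotient_reprK -!quotient_classZ.
by rewrite -quotient_classD scalerDl.
Qed.
HB.instance Definition _ := GRing.Zmodule_isLmodule.Build R quotient_module
  quotient_scaleA quotient_scale1 quotient_scaleDr quotient_scaleDl.

End QuotientModule.

(* Finite direct sum of modules; the library's pointwise module structure on
   functions only covers the non-dependent case. *)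
Section DirectSum.
Variables (R : comNzRingType) (r : nat) (V : 'I_r -> lmodType R).

Definition direct_sum : Type := forall j : 'I_r, V j.
HB.instance Definition _ := gen_eqMixin direct_sum.
HB.instance Definition _ := gen_choiceMixin direct_sum.

Implicit Types f g h : direct_sum.
Definition dsum_zero : direct_sum := fun j => 0.
Definition dsum_opp f : direct_sum := fun j => - f j.
Definition dsum_add f g : direct_sum := fun j => f j + g j.
Definition dsum_scale (a : R) f : direct_sum := fun j => a *: f j.

Lemma dsum_addA : associative dsum_add.
Proof. by move=> f g h; apply: functional_extensionality_dep => j; exact: addrA. Qed.
Lemma dsum_addC : commutative dsum_add.
Proof. by move=> f g; apply: functional_extensionality_dep => j; exact: addrC. Qed.
Lemma dsum_add0 : left_id dsum_zero dsum_add.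
Proof. by move=> f; apply: functional_extensionality_dep => j; exact: add0r. Qed.
Lemma dsum_addN : left_inverse dsum_zero dsum_opp dsum_add.
Proof. by move=> f; apply: functional_extensionality_dep => j; exact: addNr. Qed.
HB.instance Definition _ := GRing.isZmodule.Build direct_sum
  dsum_addA dsum_addC dsum_add0 dsum_addN.

Lemma dsum_scaleA a b f : dsum_scale a (dsum_scale b f) = dsum_scale (a * b) f.
Proof. by apply: functional_extensionality_dep => j; exact: scalerA. Qed.
Lemma dsum_scale1 : left_id 1 dsum_scale.
Proof. by move=> f; apply: functional_extensionality_dep => j; exact: scale1r. Qed.
Lemma dsum_scaleDr : right_distributive dsum_scale +%R.
Proof. by move=> a f g; apply: functional_extensionality_dep => j; exact: scalerDr. Qed.
Lemma dsum_scaleDl f : {morph dsum_scale^~ f : a b / a + b}.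
Proof. by move=> a b; apply: functional_extensionality_dep => j; exact: scalerDl. Qed.
HB.instance Definition _ := GRing.Zmodule_isLmodule.Build R direct_sum
  dsum_scaleA dsum_scale1 dsum_scaleDr dsum_scaleDl.

End DirectSum.

Definition isomorphic (R : comNzRingType) (U V : lmodType R) : Prop :=
  exists f : {linear U -> V}, bijective f.

Section Ideals.
Variable R : comNzRingType.

Definition ideal := submodule (R^o : lmodType R).

Definition ideal_full : ideal := submodule_full _.
Definition ideal_gen (S : set R) : ideal := span (S : set R^o).
Definition principal (a : R) : ideal := ideal_gen [set a].
Definition ideal_add (I J : ideal) : ideal := ideal_gen (I `|` J).
Definition ideal_mul (I J : ideal) : ideal :=
  ideal_gen [set z | exists x y : R, [/\ I x, J y & z = x * y]].
Definition ideal_exp (I : ideal) (n : nat) : ideal :=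
  iter n (ideal_mul I) ideal_full.
Definition ideal_prod (r : nat) (I : 'I_r -> ideal) : ideal :=
  \big[ideal_mul/ideal_full]_(j < r) I j.

Definition prime_ideal (P : ideal) : Prop :=
  ~ P (1 : R) /\ forall x y : R, P (x * y) -> P x \/ P y.

Definition maximal_ideal (P : ideal) : Prop :=
  P <> ideal_full /\
  forall J : ideal, P `<=` J -> J = P \/ J = ideal_full.

Definition noetherian : Prop :=
  forall I : ideal, exists s : seq R, I = ideal_gen [set x | x \in s].

End Ideals.

(* Fields are not excluded. *)
Record dedekind (R : idomainType) : Prop := Dedekind {
  dedekind_noetherian : noetherian R;
  dedekind_integrally_closed : forall z : {fraction R},
    integralOver (@FracField.tofrac R) z ->
    exists x : R, z = FracField.tofrac x;
  dedekind_dim1 : forall P : ideal R,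
    prime_ideal P -> (exists2 x : R, P x & x != 0) -> maximal_ideal P }.

Section ProjectiveSpace.
Variable R : comNzRingType.

Definition unimodular (a b : R) : Prop :=
  ideal_add (principal a) (principal b) = ideal_full R.

Definition unimodular_pair : Type :=
  {p : R * R | `[< unimodular p.1 p.2 >]}.
HB.instance Definition _ := Choice.on unimodular_pair.

Definition UnimodularPair (a b : R) (hab : unimodular a b) : unimodular_pair :=
  exist _ (a, b) (introT (asboolP _) hab).

Lemma unimodular_bezout (a b : R) :
  unimodular a b -> exists x y, x * a + y * b = 1.
Proof.
move=> hab; have : ideal_full R (1 : R) by [].
rewrite -hab => h1.
pose N : set R^o := [set z | exists x y, x * a + y * b = z].
have hN : is_submodule N.
  split=> [|r _ _ [x [y <-]] [x' [y' <-]]].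
    by exists 0, 0; rewrite !mul0r addr0.
  exists (r * x + x'), (r * y + y').
  by rewrite /GRing.scale /= mulrDr !mulrDl !mulrA addrACA.
apply: (h1 N); split=> // z [] hz; apply: (hz N); split=> // _ ->.
  by exists 1, 0; rewrite mul1r mul0r addr0.
by exists 0, 1; rewrite mul1r mul0r add0r.
Qed.

Variable I : ideal R.

Definition pf_rel (p q : unimodular_pair) : bool :=
  `[< I ((val p).1 * (val q).2 - (val p).2 * (val q).1) >].

Lemma pf_rel_equiv : equiv_class_of pf_rel.
Proof.
have [I0 IL] := submoduleP I.
have IZ (r u : R) : I u -> I (r * u).
  by move=> Iu; rewrite -[r * u]addr0; exact: IL.
have ID (u v : R) : I u -> I v -> I (u + v).
  by move=> Iu Iv; rewrite -[u]mul1r; exact: IL.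
have sym : forall p q, pf_rel p q -> pf_rel q p.
  move=> [[a b] hp] [[c d] hq] /asboolP /= h; apply/asboolP => /=.
  by move/(IZ (- 1)): h; rewrite mulN1r opprB [b * c]mulrC [a * d]mulrC.
split=> [[[a b] hp]|p q|q p s].
- by apply/asboolP => /=; rewrite [b * a]mulrC subrr.
- by apply/idP/idP; exact: sym.
move: p q s => [[a b] hp] [[c d] hq] [[e f] hs].
move=> /asboolP /= h1 /asboolP /= h2; apply/asboolP => /=.
have /unimodular_bezout[x [y xy1]] := asboolW hq.
rewrite /= in xy1.
have -> : a * f - b * e = x * (a * (c * f - d * e) + e * (a * d - b * c))
                        + y * (f * (a * d - b * c) + b * (c * f - d * e)).
  by rewrite -[LHS]mul1r -xy1; ring.
by apply: (ID); apply: (IZ); apply: (ID); apply: (IZ).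
Qed.

Canonical pf_rel_equivRel := EquivRelPack pf_rel_equiv.
Canonical pf_rel_encModRel := defaultEncModRel pf_rel.

Definition projective_line : Type := {eq_quot pf_rel}.

Definition pf_class (a b : R) (hab : unimodular a b) : projective_line :=
  \pi_({eq_quot pf_rel}) (UnimodularPair hab).

Lemma pf_classP a b c d (hab : unimodular a b) (hcd : unimodular c d) :
  pf_class hab = pf_class hcd <-> I (a * d - b * c).
Proof.
rewrite /pf_class; split=> [/eqmodP/asboolP //|h].
by apply/eqmodP; apply/asboolP.
Qed.

End ProjectiveSpace.
Arguments pf_class {R} I {a b} hab.

Section Invariants.
Variable R : idomainType.

Definition plane : lmodType R := (R^o * R^o)%type.

Definition cotorsion (M : submodule plane) : Prop :=
  is_torsion (quotient_module M).

Record invariant_decomposition (M : submodule plane) (r : nat)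
    (P : 'I_r -> ideal R) (n k : 'I_r -> nat) : Prop := {
  decomposition_maximal : forall j, maximal_ideal (P j);
  decomposition_distinct : injective P;
  decomposition_exponents : forall j, (n j <= k j)%N /\ k j <> 0%N;
  decomposition_iso : isomorphic (quotient_module M)
    (direct_sum (fun j => (quotient_module (ideal_exp (P j) (n j)) *
                           quotient_module (ideal_exp (P j) (k j)))%type :
                           lmodType R)) }.

(* The invariants of [M] do not depend on the decomposition chosen; they are
   introduced as relations, which hold for the values computed from some
   decomposition. *)
Definition invariant_factors (M : submodule plane) (L K : ideal R) : Prop :=
  exists (r : nat) (P : 'I_r -> ideal R) (n k : 'I_r -> nat),
    [/\ invariant_decomposition M P n k,
        L = ideal_prod (fun j => ideal_exp (P j) (n j)) &
        K = ideal_prod (fun j => ideal_exp (P j) (k j))].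

Definition projective_invariant (M : submodule plane) (I : ideal R)
    (x : projective_line I) : Prop :=
  exists (r : nat) (P : 'I_r -> ideal R) (n k : 'I_r -> nat),
    let L := ideal_prod (fun j => ideal_exp (P j) (n j)) in
    [/\ invariant_decomposition M P n k,
        I = ideal_prod (fun j => ideal_exp (P j) (k j - n j)) &
        exists (a b : R) (hab : unimodular a b) (t : R),
          [/\ (L `\` \bigcup_j ideal_mul L (P j)) t,
              M (t * a, t * b) & x = pf_class I hab]].

End Invariants.

(* Main.v *)
(* If [O^2/M] is isomorphic to [O/L + O/K], then [K] is its annihilator and [L] is the ideal
   generated by the coordinates of the elements of [M], so [L] and [K] do not depend on the
   decomposition.  Each [M_i] contains [K_i O^2], and the [K_i] are pairwise coprime; by the Chinese
   remainder theorem the quotient by the intersection of the [M_i] is the direct sum of the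
   [O^2/M_i], which settles the invariant factors.  For the projective invariant, let [t' (c, d)]
   lie in [M_i], with [t'] in [L_i] but in no [L_i P_j].  Since [P^n / P^(n+1)] is a line over
   [O/P], every [t] in [L_i] is a multiple of [t'] modulo [K_i], so [t (c, d)] lies in [M_i]; as
   [(a, b)] is a multiple of [(c, d)] modulo [I_i] and [L_i I_i = K_i], so does [t (a, b)]. *)

From HB Require Import structures.
Require Import Defs.
From mathcomp Require Import all_boot all_order all_algebra.
From mathcomp Require Import fraction ring.
From mathcomp Require Import boolp classical_sets functions cardinality.
Set Implicit Arguments.
Unset Strict Implicit.
Unset Printing Implicit Defensive.
Import GRing.Theory.
Local Open Scope ring_scope.
Local Open Scope classical_set_scope.

(** * Ideals *)

Section SubmoduleTheory.
Variables (R : comNzRingType) (V : lmodType R).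
Implicit Type N : submodule V.

Lemma submod0 N : N 0.
Proof. exact: (submoduleP N).1. Qed.

Lemma submodZ N r u : N u -> N (r *: u).
Proof. by move=> Nu; rewrite -[_ *: _]addr0; apply: (submoduleP N).2 => //; exact: submod0. Qed.

Lemma submodD N u v : N u -> N v -> N (u + v).
Proof. by move=> Nu Nv; rewrite -[u]scale1r; exact: (submoduleP N).2. Qed.

Lemma submodN N u : N u -> N (- u).
Proof. by rewrite -scaleN1r; exact: submodZ. Qed.

Lemma submodB N u v : N u -> N v -> N (u - v).
Proof. by move=> Nu Nv; apply: submodD => //; exact: submodN. Qed.

Lemma submod_sum N (T : Type) (s : seq T) (p : pred T) (u : T -> V) :
  (forall i, p i -> N (u i)) -> N (\sum_(i <- s | p i) u i).
Proof.
by move=> h; elim/big_rec: _ => [|i v pi Nv]; [exact: submod0|exact: submodD (h _ pi) Nv].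
Qed.

Lemma submod_eq N N' : (forall u, N u <-> N' u) -> N = N'.
Proof. by move=> h; apply: submodule_ext; apply/seteqP; split=> u /h. Qed.

Lemma span_min N (S : set V) u : S `<=` N -> Defs.span S u -> N u.
Proof. by move=> SN; apply; split=> //; exact: submoduleP. Qed.

Lemma mem_span (S : set V) u : S u -> Defs.span S u.
Proof. by move=> Su N [_]; exact. Qed.

End SubmoduleTheory.

Section IdealTheory.
Variable R : comNzRingType.
Implicit Types (I J H A : ideal R) (x y z r : R).

Lemma mem_idealM I r x : I x -> I (r * x).
Proof. exact: (@submodZ R R^o). Qed.

Lemma mem_idealMr I r x : I x -> I (x * r).
Proof. by rewrite mulrC; exact: mem_idealM. Qed.

Lemma ideal_fullE I : I 1 -> I = ideal_full R.
Proof. by move=> I1; apply: submod_eq => x; split=> // _; rewrite -[x]mulr1; exact: mem_idealM. Qed.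

Lemma is_submodule_colon (N : set R^o) (A : set R) :
  is_submodule N -> is_submodule ([set x | forall a, A a -> N (x * a)] : set R^o).
Proof.
move=> [N0 NL]; split=> [a _|r u v /= Nu Nv a Aa]; first by rewrite mul0r.
by rewrite mulrDl -mulrA; apply: NL; [exact: Nu|exact: Nv].
Qed.
(** The ideal quotient [N : A]. It turns [x A] lying in [N] into membership of [x] in an ideal,
    which can be checked on generators; [A] is any set, so that single elements and ideals are both
    covered. *)
Definition colon (N : ideal R) (A : set R) : ideal R :=
  Submodule (is_submodule_colon A (submoduleP N)).

Lemma colonP (N : ideal R) (A : set R) x : colon N A x <-> forall a, A a -> N (x * a).
Proof. by []. Qed.

Lemma mem_ideal_mul I J x y : I x -> J y -> ideal_mul I J (x * y).
Proof. by move=> Ix Jy; apply: mem_span; exists x, y. Qed.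

Lemma ideal_mul_min I J H z :
  (forall x y, I x -> J y -> H (x * y)) -> ideal_mul I J z -> H z.
Proof. by move=> h; apply: span_min => _ [x [y [Ix Jy ->]]]; exact: h. Qed.

Lemma ideal_mulC : commutative (@ideal_mul R).
Proof.
move=> I J; apply: submod_eq => z.
by split; apply: ideal_mul_min => x y Ix Jy; rewrite mulrC; exact: mem_ideal_mul.
Qed.

Lemma ideal_mulA : associative (@ideal_mul R).
Proof.
suff h I J H z : ideal_mul (ideal_mul I J) H z -> ideal_mul I (ideal_mul J H) z.
  move=> I J H; apply: submod_eq => z; split=> [|/h//].
  rewrite ideal_mulC [ideal_mul J H]ideal_mulC [ideal_mul (ideal_mul I J) H]ideal_mulC.
  by rewrite [ideal_mul I J]ideal_mulC; exact: h.
apply: ideal_mul_min => u w IJu Hw.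
suff : colon (ideal_mul I (ideal_mul J H)) H u by exact.
move: IJu; apply: ideal_mul_min => x y Ix Jy a Ha.
by rewrite -mulrA; do 2!apply: mem_ideal_mul => //.
Qed.

Lemma ideal_mul1 : left_id (ideal_full R) (@ideal_mul R).
Proof.
move=> I; apply: submod_eq => z; split=> [|Iz]; last by rewrite -[z]mul1r; exact: mem_ideal_mul.
by apply: ideal_mul_min => x y _; exact: mem_idealM.
Qed.

HB.instance Definition _ :=
  Monoid.isComLaw.Build (ideal R) (ideal_full R) (@ideal_mul R)
    ideal_mulA ideal_mulC ideal_mul1.

Lemma ideal_mulS I I' J J' :
  I `<=` I' -> J `<=` J' -> ideal_mul I J `<=` ideal_mul I' J'.
Proof.
move=> hI hJ z; apply: (ideal_mul_min (H := ideal_mul I' J')) => x y Ix Jy.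
by apply: mem_ideal_mul; [exact: hI|exact: hJ].
Qed.

Lemma ideal_mul_subr I J : ideal_mul I J `<=` J.
Proof. by move=> z; apply: (ideal_mul_min (H := J)) => x y _; exact: mem_idealM. Qed.

Lemma ideal_mul_subl I J : ideal_mul I J `<=` I.
Proof. by rewrite ideal_mulC; exact: ideal_mul_subr. Qed.

Lemma ideal_bigS (T : Type) (s : seq T) (p : pred T) (I J : T -> ideal R) :
  (forall i, p i -> I i `<=` J i) ->
  \big[@ideal_mul R/ideal_full R]_(i <- s | p i) I i `<=`
  \big[@ideal_mul R/ideal_full R]_(i <- s | p i) J i.
Proof.
move=> h; elim/big_rec2: _ => [//|i A B pi]; apply: ideal_mulS; exact: h.
Qed.

Lemma ideal_big_sub (T : finType) (I : T -> ideal R) i :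
  \big[@ideal_mul R/ideal_full R]_j I j `<=` I i.
Proof. rewrite (bigD1 i) //=; exact: ideal_mul_subl. Qed.

Lemma ideal_exp1 I : ideal_exp I 1 = I.
Proof. by rewrite /ideal_exp /= ideal_mulC ideal_mul1. Qed.

Lemma ideal_expD I m n : ideal_exp I (m + n) = ideal_mul (ideal_exp I m) (ideal_exp I n).
Proof.
elim: m => [|m ih]; first by rewrite ideal_mul1.
by rewrite addSn /= -/(ideal_exp I (m + n)) ih ideal_mulA.
Qed.

Lemma ideal_exp_sub I m n : (m <= n)%N -> ideal_exp I n `<=` ideal_exp I m.
Proof. by move=> /subnKC <-; rewrite ideal_expD; exact: ideal_mul_subl. Qed.

Lemma ideal_exp_sub1 I n : n <> 0%N -> ideal_exp I n `<=` I.
Proof. by case: n => // n _; exact: ideal_mul_subl. Qed.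

Lemma ideal_exp_mul I J n :
  ideal_exp (ideal_mul I J) n = ideal_mul (ideal_exp I n) (ideal_exp J n).
Proof.
elim: n => [|n ih]; first by rewrite ideal_mul1.
by rewrite /= -!/(ideal_exp _ _) ih; exact: Monoid.mulmACA.
Qed.

Lemma principalP x z : principal x z <-> exists r, z = r * x.
Proof.
split=> [|[r ->]]; last by apply: mem_idealM; exact: mem_span.
have hN : is_submodule ([set z | exists r, z = r * x] : set R^o).
  split=> [|r _ _ [s ->] [s' ->]]; first by exists 0; rewrite mul0r.
  by exists (r * s + s'); rewrite mulrDl -mulrA.
by apply: (span_min (N := Submodule hN)) => _ ->; exists 1; rewrite mul1r.
Qed.

Lemma principal_exp x n : ideal_exp (principal x) n = principal (x ^+ n).
Proof.
elim: n => [|n ih].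
  by symmetry; apply: ideal_fullE; apply/principalP; exists 1; rewrite mulr1.
rewrite /= -/(ideal_exp _ _) ih; apply: submod_eq => z; split.
  apply: ideal_mul_min => _ _ /principalP[r ->] /principalP[s ->].
  by apply/principalP; exists (r * s); rewrite exprS mulrACA.
case/principalP=> r ->; rewrite exprS mulrA.
by apply: mem_ideal_mul; apply/principalP; [exists r|exists 1; rewrite mul1r].
Qed.

Lemma ideal_addP I J z : ideal_add I J z <-> exists x y, [/\ I x, J y & z = x + y].
Proof.
split=> [|[x [y [Ix Jy ->]]]]; last by apply: (@submodD _ R^o); apply: mem_span; [left|right].
have hN : is_submodule ([set z | exists x y, [/\ I x, J y & z = x + y]] : set R^o).
  split=> [|r _ _ [x [y [Ix Jy ->]]] [x' [y' [Ix' Jy' ->]]]].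
    by exists 0, 0; split; [exact: submod0|exact: submod0|rewrite addr0].
  exists (r * x + x'), (r * y + y'); split.
  - by apply: (@submodD _ R^o) => //; exact: mem_idealM.
  - by apply: (@submodD _ R^o) => //; exact: mem_idealM.
  - by rewrite /GRing.scale /= mulrDr addrACA.
apply: (span_min (N := Submodule hN)) => x [Ix|Jx] /=.
  by exists x, 0; split=> //; [exact: submod0|rewrite addr0].
by exists 0, x; split=> //; [exact: submod0|rewrite add0r].
Qed.

Definition coprime_ideals I J := exists x y, [/\ I x, J y & x + y = 1].

Lemma ideal_add_full I J : ideal_add I J = ideal_full R <-> coprime_ideals I J.
Proof.
split=> [h|[x [y [Ix Jy e]]]].
  have /ideal_addP[x [y [Ix Jy e]]] : ideal_add I J 1 by rewrite h.
  by exists x, y.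
by apply: ideal_fullE; apply/ideal_addP; exists x, y.
Qed.

Lemma coprime_ideals_sym I J : coprime_ideals I J -> coprime_ideals J I.
Proof. by move=> [x [y [Ix Jy e]]]; exists y, x; split=> //; rewrite addrC. Qed.

Lemma coprime_ideals_full I : coprime_ideals I (ideal_full R).
Proof. by exists 0, 1; split=> //; [exact: submod0|rewrite add0r]. Qed.

Lemma coprime_ideals_mul I J H :
  coprime_ideals I J -> coprime_ideals I H -> coprime_ideals I (ideal_mul J H).
Proof.
move=> [x [y [Ix Jy e]]] [x' [y' [Ix' Hy' e']]].
exists (x + y * x'), (y * y'); split; last 1 first.
- by rewrite -addrA -mulrDr e' mulr1.
- by apply: (@submodD _ R^o) => //; exact: mem_idealM.
- exact: mem_ideal_mul.
Qed.

Lemma coprime_ideals_big I (T : Type) (s : seq T) (p : pred T) (J : T -> ideal R) :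
  (forall i, p i -> coprime_ideals I (J i)) ->
  coprime_ideals I (\big[@ideal_mul R/ideal_full R]_(i <- s | p i) J i).
Proof.
move=> h; elim/big_rec: _ => [|i A pi hA]; first exact: coprime_ideals_full.
by apply: coprime_ideals_mul => //; exact: h.
Qed.

Lemma coprime_ideals_exp I J m n :
  coprime_ideals I J -> coprime_ideals (ideal_exp I m) (ideal_exp J n).
Proof.
move=> h; have h1 k A B : coprime_ideals A B -> coprime_ideals A (ideal_exp B k).
  move=> hAB; elim: k => [|k ih]; first exact: coprime_ideals_full.
  exact: coprime_ideals_mul.
by apply: (h1); apply: coprime_ideals_sym; apply: (h1); exact: coprime_ideals_sym.
Qed.

Lemma ideal_mul_coprime I J z : coprime_ideals I J -> I z -> J z -> ideal_mul I J z.
Proof.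
move=> [x [y [Ix Jy e]]] Iz Jz; rewrite -[z]mul1r -e mulrDl.
by apply: (@submodD _ R^o); [|rewrite mulrC]; exact: mem_ideal_mul.
Qed.

(** * Pairwise coprime families of ideals and the Chinese remainder theorem *)

Section CoprimeFamily.
Variables (T : finType) (I : T -> ideal R).
Hypothesis coI : forall i j, i != j -> coprime_ideals (I i) (I j).

Lemma ideal_big_coprime z :
  (\big[@ideal_mul R/ideal_full R]_i I i) z <-> forall i, I i z.
Proof.
split=> [h i|h]; first exact: (@ideal_big_sub T I i).
elim: (index_enum T) (index_enum_uniq T) => [|i s ih]; first by rewrite big_nil.
rewrite cons_uniq => /andP[nis us]; rewrite big_cons.
apply: ideal_mul_coprime => //; last exact: ih.
rewrite big_seq; apply: coprime_ideals_big => j js; apply: coI.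
by apply: contraNneq nis => ->.
Qed.

(** [I i] is coprime to the product of the other ideals; [e i] is the summand of 1 lying in that
    product. *)
Lemma ideal_chinese_idempotents : exists e : T -> R,
  forall i, I i (1 - e i) /\ forall j, j != i -> I j (e i).
Proof.
suff h i : exists e, I i (1 - e) /\ forall j, j != i -> I j e.
  by have [e he] := choice h; exists e.
have [x [y [Ix Jy e]]] := @coprime_ideals_big (I i) T (index_enum T)
  [pred j | i != j] I (fun j => @coI i j).
exists y; rewrite -{1}e addrK; split=> // j ji.
have ij : i != j by rewrite eq_sym.
by move: Jy; rewrite (bigD1 j ij) /=; exact: ideal_mul_subl.
Qed.

(** The vector [\sum_i e i *: u i] serves all submodules [N] containing [I i V] at once. With
    [V = R] this is the usual remainder theorem; with the plane it glues vectors given modulo the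
    [M i]. *)
Lemma ideal_chinese_lift (V : lmodType R) (u : T -> V) : exists v : V,
  forall (N : submodule V) i, (forall x w, I i x -> N (x *: w)) -> N (v - u i).
Proof.
have [e he] := ideal_chinese_idempotents; exists (\sum_i e i *: u i) => N i hN.
rewrite (bigD1 i) //= addrAC -{2}[u i]scale1r -scalerBl.
apply: submodD; first by rewrite -opprB scaleNr; apply/submodN/hN; exact: (he i).1.
by apply: submod_sum => j ji; apply: hN; apply: (he j).2; rewrite eq_sym.
Qed.

Lemma ideal_chinese_remainder (c : T -> R) : exists x, forall i, I i (x - c i).
Proof.
have [x hx] := ideal_chinese_lift (c : T -> R^o); exists x => i.
by apply: hx => a w Ia; rewrite /GRing.scale /=; exact: mem_idealMr.
Qed.

End CoprimeFamily.

Lemma maximal_ideal_comax (P : ideal R) x :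
  maximal_ideal P -> ~ P x -> exists p r, P p /\ p + r * x = 1.
Proof.
move=> [nP hP] nPx.
have [e|e] := hP (ideal_add P (principal x)) (fun z Pz => mem_span (or_introl Pz)).
  by case: nPx; rewrite -e; apply: mem_span; right; exact: mem_span.
move/ideal_add_full: e => [p [y [Pp /principalP[r ->] e]]]; by exists p, r.
Qed.

Lemma maximal_ideals_coprime (P Q : ideal R) :
  maximal_ideal P -> maximal_ideal Q -> P <> Q -> coprime_ideals P Q.
Proof.
move=> mP mQ nPQ; have [QP|nQP] := EM (Q `<=` P).
  by case: (mQ.2 P QP) => // e; case: mP.1.
have [x Qx nPx] : exists2 x, Q x & ~ P x.
  by apply: contrapT => h; apply: nQP => x Qx; apply: contrapT => nPx; apply: h; exists x.
have [p [r [Pp e]]] := maximal_ideal_comax mP nPx.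
by exists p, (r * x); split=> //; exact: mem_idealM.
Qed.

Lemma maximal_ideal_proper (P : ideal R) : maximal_ideal P -> ~ P 1.
Proof. by move=> [nP _] P1; apply: nP; exact: ideal_fullE. Qed.

End IdealTheory.

(** * Dedekind domains *)

Section Noetherian.
Variable R : comNzRingType.

Lemma ideal_gen_seqP (s : seq R) z : ideal_gen [set x | x \in s] z <->
  exists c : 'I_(size s) -> R, z = \sum_i c i * s`_i.
Proof.
split=> [|[c ->]]; last first.
  apply: (@submod_sum _ R^o) => i _; apply: mem_idealM; apply: mem_span => /=; exact: mem_nth.
have hN : is_submodule ([set z | exists c : 'I_(size s) -> R, z = \sum_i c i * s`_i] : set R^o).
  split=> [|r _ _ [c ->] [c' ->]].
    by exists (fun=> 0); rewrite big1 // => i _; rewrite mul0r.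
  exists (fun i => r * c i + c' i); rewrite /GRing.scale /= mulr_sumr -big_split /=.
  by apply: eq_bigr => i _; rewrite mulrDl mulrA.
apply: (span_min (N := Submodule hN)) => x /= xs.
have i0 : (index x s < size s)%N by rewrite index_mem.
exists (fun i => (i == Ordinal i0)%:R); rewrite (bigD1 (Ordinal i0)) //= eqxx mul1r nth_index //.
by rewrite big1 ?addr0 // => i /negPf ->; rewrite mul0r.
Qed.

(** Without a maximal element, choice yields a strictly ascending chain in [S]. Its union is
    finitely generated, and all generators already lie in one term, where the chain has to stop. *)
Lemma noetherian_maximal (S : set (ideal R)) (I0 : ideal R) : noetherian R -> S I0 ->
  exists2 I, S I & forall J, S J -> I `<=` J -> J = I.
Proof.
move=> nR SI0; apply: contrapT => noM.
have /choice[f hf] (I : ideal R) : exists J, S I -> [/\ S J, I `<=` J & ~ J `<=` I].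
  have [SI|] := EM (S I); last by exists I.
  apply: contrapT => noJ; apply: noM; exists I => // J SJ IJ.
  apply: submodule_ext; apply/seteqP; split=> //; apply: contrapT => nJI.
  by apply: noJ; exists J.
pose c n := iter n f I0.
have Sc n : S (c n) by elim: n => //= n /hf[].
have cS m n : (m <= n)%N -> c m `<=` c n.
  move=> /subnKC <-; elim: (n - m)%N => [|k ih]; first by rewrite addn0.
  by rewrite addnS; apply: subset_trans ih _; case: (hf _ (Sc (m + k)%N)).
have hU : is_submodule ([set z | exists n, c n z] : set R^o).
  split=> [|r u v [m cu] [n cv]]; first by exists 0%N; exact: (@submod0 _ R^o).
  exists (maxn m n); apply: (submoduleP (c (maxn m n))).2.
    by apply: cS cu; exact: leq_maxl.
  by apply: cS cv; exact: leq_maxr.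
have [s sU] := nR (Submodule hU).
have [N sN] : exists N, forall x, x \in s -> c N x.
  have : forall x, x \in s -> exists n, c n x.
    move=> x xs; suff : Submodule hU x by [].
    by rewrite sU; exact: mem_span.
  elim: s {sU} => [|x s ih] hs; first by exists 0%N.
  have [N hN] := ih (fun y ys => hs y (mem_behead (s := x :: s) ys)).
  have [n hn] := hs x (mem_head _ _).
  exists (maxn N n) => y; rewrite inE => /orP[/eqP ->|/hN].
    by apply: cS hn; exact: leq_maxr.
  by apply: cS; exact: leq_maxl.
have [_ _] := hf _ (Sc N); apply=> z cz.
have : Submodule hU z by exists N.+1.
by rewrite sU; apply: span_min.
Qed.

End Noetherian.

Section Dedekind.
Variable R : idomainType.
Hypothesis hR : dedekind R.

(* By Cayley-Hamilton, [y / x] is integral. *)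
Lemma stable_multiplier (P : ideal R) x y : x != 0 -> (exists2 p, P p & p != 0) ->
  (forall p, P p -> exists2 w, P w & y * p = x * w) -> exists r, y = r * x.
Proof.
move=> x0 [p0 Pp0 p00] stab.
have [s eP] := dedekind_noetherian hR P.
have hA (i : 'I_(size s)) : exists c : 'I_(size s) -> R, y * s`_i = x * \sum_j c j * s`_j.
  have /stab[w Pw ->] : P s`_i by rewrite eP; apply: mem_span => /=; exact: mem_nth.
  by move: Pw; rewrite eP => /ideal_gen_seqP[c ->]; exists c.
have [A {}hA] := choice hA.
pose tf := @FracField.tofrac R.
have tx0 : tf x != 0 by rewrite tofrac_eq0.
(* Transposed, so that the row of generators of [P] is an eigenvector for [y / x], which is then a
   root of the monic [char_poly B]. *)
pose B := \matrix_(j, i) A i j : 'M[R]_(size s).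
have [|r er] := dedekind_integrally_closed hR (z := tf y / tf x); last first.
  exists r; apply/eqP; rewrite -(tofrac_eq (R := R)) rmorphM /= -er.
  by rewrite divfK.
exists (char_poly B); first exact: char_poly_monic.
rewrite map_char_poly -eigenvalue_root_char; apply/eigenvalueP.
exists (\row_i tf s`_i).
  apply/rowP => i; rewrite !mxE mulrAC; apply: (canRL (mulfK tx0)).
  rewrite -rmorphM hA rmorphM rmorph_sum mulrC; congr (_ * _); apply: eq_bigr => j _.
  by rewrite !mxE rmorphM mulrC.
(* The eigenvector is nonzero: otherwise all generators of [P] vanish, and so does [p0]. *)
apply: contraNneq p00 => /rowP v0; move: Pp0; rewrite eP => /ideal_gen_seqP[c ->].
apply/eqP; apply: big1 => i _; have := v0 i; rewrite !mxE => /eqP.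
by rewrite tofrac_eq0 => /eqP ->; rewrite mulr0.
Qed.

(* Among the ideals [(x) : z] contained in [P], a maximal one is prime, hence equal to [P]. *)
Lemma maximal_ideal_colon (P : ideal R) x : maximal_ideal P -> P x -> x != 0 ->
  exists2 z, ~ principal x z & forall p, P p -> principal x (p * z).
Proof.
move=> mP Px x0.
pose C z := colon (principal x) [set z].
have CE z u : C z u <-> principal x (u * z) by split=> [|? _ ->//]; apply.
pose S : set (ideal R) := [set J : ideal R | J `<=` P /\ exists z, J = C z].
have [|J [JP [z eJ]] Jmax] := noetherian_maximal (S := S) (I0 := C 1) (dedekind_noetherian hR).
  split; last by exists 1.
  by move=> u /CE; rewrite mulr1 => /principalP[r ->]; exact: mem_idealM.
have nJ1 : ~ J 1 by move=> /JP; exact: maximal_ideal_proper.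
have JE u : J u <-> principal x (u * z) by rewrite eJ.
exists z => [xz|p Pp]; first by apply: nJ1; apply/JE; rewrite mul1r.
(* [C (s * z)] contains [J], and it stays inside [P] because the maximal ideal [P] is prime;
   maximality of [J] gives equality. *)
have hS s : ~ P s -> C (s * z) = J.
  move=> nPs; apply: Jmax; last first.
    move=> u /JE xu; apply/CE; rewrite mulrCA; exact: mem_idealM.
  split; last by exists (s * z).
  move=> u /CE; rewrite mulrA => /JE /JP Pus.
  apply: contrapT => nPu.
  have [q [r [Pq e]]] := maximal_ideal_comax mP nPu; apply: nPs.
  rewrite -[s]mul1r -e mulrDl -mulrA; apply: (@submodD _ R^o); first exact: mem_idealMr.
  exact: mem_idealM.
have pJ : prime_ideal J.
  split=> // u v Juv; have [|nJu] := EM (J u); first by left.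
  (* Either [C (u * z)] lies in [P], hence equals [J] and contains [v]; or it has an element [s]
     outside [P], and then [u] lies in [C (s * z) = J]. *)
  right; have [CP|] := EM (C (u * z) `<=` P).
    have -> : J = C (u * z).
      symmetry; apply: Jmax; first by split=> //; exists (u * z).
      by move=> w /JE xw; apply/CE; rewrite mulrCA; exact: mem_idealM.
    by apply/CE; rewrite mulrCA mulrA; apply/JE.
  move=> nCP; case: nJu.
  have [s Cs nPs] : exists2 s, C (u * z) s & ~ P s.
    apply: contrapT => h; apply: nCP => s Cs; apply: contrapT => nPs; apply: h.
    by exists s.
  by rewrite -(hS s nPs); apply/CE; rewrite mulrCA; apply/CE.
have [|_ /(_ P JP)] := dedekind_dim1 hR pJ.
  by exists x => //; apply/JE; rewrite mulrC; apply: mem_idealM; exact: mem_span.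
by case=> [eP|eP]; [apply/JE; rewrite -eP|case: mP.1].
Qed.

(** Take [0 != x] in [P] and [Q = (x) : P], so that [P Q] lies in [(x)]. The ideal [B = P Q : x]
    contains [P]. If [B = P], the [z] of the previous lemma satisfies [z P <= x P], whence [z] is in
    [(x)], which is false; so [B] is the whole ring and [x] lies in [P Q]. *)
Lemma maximal_ideal_invertible (P : ideal R) : maximal_ideal P ->
  (exists2 p, P p & p != 0) -> exists Q x, x != 0 /\ ideal_mul P Q = principal x.
Proof.
move=> mP [x Px x0]; have [z nxz hz] := maximal_ideal_colon mP Px x0.
pose Q := colon (principal x) P.
have PQ u : ideal_mul P Q u -> principal x u.
  by apply: ideal_mul_min => p q Pp Qq; rewrite mulrC; exact: Qq.
have Qx : Q x by apply/colonP=> p Pp; rewrite mulrC; apply: mem_idealM; exact: mem_span.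
have Qz : Q z by apply/colonP=> p Pp; rewrite mulrC; exact: hz.
exists Q, x; split=> //; apply: submod_eq => u; split=> [/PQ //|].
suff PQx : ideal_mul P Q x by case/principalP=> r ->; exact: mem_idealM.
pose B := colon (ideal_mul P Q) [set x].
have [|eB|eB] := mP.2 B; first by move=> p Pp; apply/colonP => _ ->; exact: mem_ideal_mul.
- case: nxz; apply/principalP; apply: (@stable_multiplier P) => //; first by exists x.
  move=> p Pp; have /principalP[w e] := hz p Pp.
  exists w; last by rewrite mulrC e mulrC.
  by rewrite -eB; apply/colonP => _ ->; rewrite -e; exact: mem_ideal_mul.
- have : B 1 by rewrite eB.
  by move=> /(_ x erefl); rewrite mul1r.
Qed.

(* With [P Q = (x)], write [t Q^n = x^n B]; then [B P^n = (t)], and [B] is not contained in [P]. *)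
Lemma ideal_exp_succ_generator (P : ideal R) n t u : maximal_ideal P ->
  ideal_exp P n t -> ~ ideal_exp P n.+1 t -> ideal_exp P n u ->
  exists r, ideal_exp P n.+1 (u - r * t).
Proof.
(* The case [P = 0] arises when [R] is a field. Then [n = 0], since otherwise [t = 0] would lie in
   every power, and [t] is invertible modulo [P]. *)
move=> mP Pt nPt Pu; have [nz|allz] := EM (exists2 p, P p & p != 0); last first.
  have z0 p : P p -> p = 0.
    by move=> Pp; apply: contrapT => /eqP p0; apply: allz; exists p.
  have n0 : n = 0%N.
    apply: contrapT => n0; case: nPt; have -> : t = 0 by apply/z0/(ideal_exp_sub1 n0).
    exact: submod0.
  move: nPt Pt Pu; rewrite n0 ideal_exp1 => nPt _ _.
  have [q [r [Pq e]]] := maximal_ideal_comax mP nPt.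
  exists (u * r); have -> : u - u * r * t = u * q; last exact: mem_idealM.
  by rewrite -{1}[u]mulr1 -e; ring.
have [Q [x [x0 ePQ]]] := maximal_ideal_invertible mP nz.
have PQn : ideal_mul (ideal_exp P n) (ideal_exp Q n) = principal (x ^+ n).
  by rewrite -ideal_exp_mul ePQ principal_exp.
have xn0 : x ^+ n != 0 by rewrite expf_neq0.
have hPQ p q : ideal_exp P n p -> ideal_exp Q n q -> exists w, p * q = w * x ^+ n.
  by move=> Pp Qq; apply/principalP; rewrite -PQn; exact: mem_ideal_mul.
(* If some such [b] is outside [P], write [p + r * b = 1] and [u * q = w * x ^+ n]. Then
   [b * u = w * t], so [u - r * w * t = p * u] is in [P^(n+1)]. *)
have [[b [q [Qq eb nPb]]]|allP] := EM (exists b q,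
    [/\ ideal_exp Q n q, t * q = b * x ^+ n & ~ P b]).
  have [p [r [Pp e]]] := maximal_ideal_comax mP nPb.
  have [w ew] := hPQ u q Pu Qq.
  exists (r * w); have -> : u - r * w * t = p * u; last exact: mem_ideal_mul.
  have buwt : b * u = w * t.
    apply: (mulIf xn0); rewrite mulrAC -eb [RHS]mulrAC -ew; ring.
  by rewrite -mulrA -buwt -{1}[u]mul1r -e; ring.
exfalso; apply: nPt.
(* Otherwise [t Q^n] lies in [x^n P]. Multiplying by [P^n] puts [t * x ^+ n] in [x^n P^(n+1)], and
   [x ^+ n] cancels. *)
have hZ : is_submodule ([set z | exists2 w, ideal_exp P n.+1 w & t * z = w * x ^+ n] : set R^o).
  split=> [|r z z' [w Pw e] [w' Pw' e']].
    by exists 0; [exact: (@submod0 _ R^o)|rewrite mulr0 mul0r].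
  exists (r * w + w').
    by apply: (@submodD _ R^o) => //; exact: (@mem_idealM _ (ideal_exp P n.+1)).
  by rewrite mulrDr e' mulrDl; congr (_ + _); rewrite mulrCA e mulrA.
suff /(_ (x ^+ n))[|w Pw /(mulIf xn0) -> //] :
    forall z, ideal_mul (ideal_exp P n) (ideal_exp Q n) z -> Submodule hZ z.
  by rewrite PQn; exact: mem_span.
move=> z; apply: ideal_mul_min => p q Pp Qq.
have [b eb] := hPQ t q Pt Qq; exists (b * p).
  apply: mem_ideal_mul => //; apply: contrapT => nPb; apply: allP.
  by exists b, q.
by rewrite mulrCA eb; ring.
Qed.

(** Successive approximation. The error is kept in [P^(k+n) = P^k P^n], so that the previous lemma
    applies to the factor in [P^n] and gains one power of [P]. *)
Lemma ideal_exp_generator (P : ideal R) n t u k : maximal_ideal P ->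
  ideal_exp P n t -> ~ ideal_exp P n.+1 t -> ideal_exp P n u ->
  exists r, ideal_exp P k (u - r * t).
Proof.
move=> mP Pt nPt Pu.
suff [r hr] : exists r, ideal_exp P (k + n) (u - r * t).
  by exists r; apply: ideal_exp_sub hr; exact: leq_addr.
elim: k => [|k [r hr]]; first by exists 0; rewrite mul0r subr0.
have hZ : is_submodule ([set z | exists r, ideal_exp P (k.+1 + n) (z - r * t)] : set R^o).
  split=> [|a z z' [s hs] [s' hs']].
    by exists 0; rewrite mul0r subr0; exact: (@submod0 _ R^o).
  exists (a * s + s'); have -> : a *: z + z' - (a * s + s') * t = a * (z - s * t) + (z' - s' * t).
    by rewrite /GRing.scale /=; ring.
  by apply: (@submodD _ R^o) => //; exact: (@mem_idealM _ (ideal_exp P (k.+1 + n))).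
suff h z : ideal_exp P (k + n) z -> Submodule hZ z.
  have [s hs] := h _ hr; exists (s + r).
  by have -> : u - (s + r) * t = u - r * t - s * t by ring.
rewrite ideal_expD; apply: ideal_mul_min => p q Pp Pq.
have [s hs] := ideal_exp_succ_generator mP Pt nPt Pq.
exists (p * s); have -> : p * q - p * s * t = p * (q - s * t) by ring.
by rewrite addSnnS ideal_expD; exact: mem_ideal_mul.
Qed.

End Dedekind.

(** * Quotient modules *)

Section QuotientIsomorphism.
Variables (R : comNzRingType) (V W : lmodType R) (N : submodule V).

Lemma quotient_class_linear : linear (quotient_class N).
Proof. by move=> a u v; rewrite quotient_classD quotient_classZ. Qed.

Lemma quotient_class_eq0 u : quotient_class N u = 0 <-> N u.
Proof.
have <- : quotient_class N 0 = 0.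
  by apply: (addrI (quotient_class N 0)); rewrite -quotient_classD !addr0.
by rewrite quotient_classP subr0.
Qed.

Section Factor.
Variable phi : V -> W.
Hypotheses (phi_linear : linear phi) (phi_ker : forall u, phi u = 0 <-> N u).

Lemma linear_kernelP u v : phi u = phi v <-> N (u - v).
Proof.
rewrite -phi_ker; have -> : phi (u - v) = phi u - phi v.
  by rewrite addrC -scaleN1r phi_linear scaleN1r addrC.
by split=> [->|/eqP]; rewrite ?subrr // subr_eq0 => /eqP.
Qed.

Definition quotient_factor (x : quotient_module N) : W := phi (quotient_repr x).

Lemma quotient_factorE u : quotient_factor (quotient_class N u) = phi u.
Proof. by apply/linear_kernelP/quotient_classP; rewrite quotient_reprK. Qed.

Lemma quotient_factor_linear : linear quotient_factor.
Proof.
move=> a x y; rewrite -[x]quotient_reprK -[y]quotient_reprK -quotient_class_linear.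
by rewrite !quotient_factorE phi_linear.
Qed.

HB.instance Definition _ :=
  GRing.isLinear.Build R (quotient_module N) W *:%R quotient_factor quotient_factor_linear.

Lemma quotient_isomorphic : (forall w, exists u, phi u = w) -> isomorphic (quotient_module N) W.
Proof.
move=> /choice[g hg]; exists quotient_factor.
exists (fun w => quotient_class N (g w)) => [x|w].
  rewrite -[x]quotient_reprK /= quotient_factorE; apply/quotient_classP/linear_kernelP; exact: hg.
by rewrite /= quotient_factorE.
Qed.

End Factor.

(** Replaces an isomorphism out of a quotient by a surjective linear map with kernel [N], so that
    decompositions can be combined on vectors instead of classes. *)
Lemma isomorphic_quotientP : isomorphic (quotient_module N) W <->
  exists phi : V -> W,
    [/\ linear phi, forall u, phi u = 0 <-> N u & forall w, exists u, phi u = w].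
Proof.
split=> [[f [g fK gK]]|[phi [lphi kphi sphi]]]; last exact: quotient_isomorphic lphi kphi sphi.
exists (fun u => f (quotient_class N u)); split=> [a u v|u|w].
- by rewrite quotient_class_linear linearP.
- rewrite -quotient_class_eq0 -{1}(raddf0 f); split=> [|->//].
  exact: (can_inj fK).
- by exists (quotient_repr (g w)); rewrite quotient_reprK.
Qed.

End QuotientIsomorphism.

(** * Invariants of a submodule of the plane *)

Lemma quotient_class_scale1 (R : comNzRingType) (I : ideal R) (x : R) :
  quotient_class I (x : R^o) = x *: quotient_class I (1 : R^o).
Proof. by rewrite -[in LHS](mulr1 x); exact: quotient_classZ. Qed.

(** Modulo [J] the matrix with rows [(p, q)] and [(r, s)] is lower unitriangular, so its determinant
    is 1. *)
Lemma ideal_det_unit (R : comNzRingType) (J : ideal R) (p q r s z : R) :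
  J (1 - p) -> J (1 - s) -> J (- q) -> J (z * (p * s - q * r)) -> J z.
Proof.
move=> hp hs hq hz.
have -> : z = z * (1 - p) + (z * p * (1 - s) + (z * (p * s - q * r) - z * r * (- q))) by ring.
apply: (@submodD _ R^o); first exact: mem_idealM.
apply: (@submodD _ R^o); first exact: mem_idealM.
by apply: (@submodB _ R^o) => //; exact: mem_idealM.
Qed.

Section Decomposition.
Variables (R : idomainType) (M : submodule (plane R)).
Variables (r : nat) (P : 'I_r -> ideal R) (n k : 'I_r -> nat).
Hypothesis D : invariant_decomposition M P n k.

Let L := ideal_prod (fun j => ideal_exp (P j) (n j)).
Let K := ideal_prod (fun j => ideal_exp (P j) (k j)).

Lemma decomposition_coprime (f : 'I_r -> nat) i j : i != j ->
  coprime_ideals (ideal_exp (P i) (f i)) (ideal_exp (P j) (f j)).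
Proof.
move=> ij; apply/coprime_ideals_exp/maximal_ideals_coprime; try exact: (decomposition_maximal D).
by move=> /(decomposition_distinct D) /eqP; apply/negP.
Qed.

(** The exponents are arbitrary because the lemma is applied to [n], [k], [k - n] and [n] raised by
    one at a single prime. *)
Lemma decomposition_prodP (f : 'I_r -> nat) x :
  ideal_prod (fun j => ideal_exp (P j) (f j)) x <-> forall j, ideal_exp (P j) (f j) x.
Proof. exact: (ideal_big_coprime (decomposition_coprime f)). Qed.

Lemma decomposition_sub : K `<=` L.
Proof.
apply: ideal_bigS => j _; apply: ideal_exp_sub.
exact: (decomposition_exponents D j).1.
Qed.

(** This is the isomorphism of the quotient with [O/L + O/K]: [g1] and [g2] lift the tuples with 1
    in every first, respectively second, slot, and by the Chinese remainder theorem their classes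
    generate. *)
Lemma decomposition_generators : exists g1 g2 : plane R,
  (forall u, exists x y, M (u - (x *: g1 + y *: g2))) /\
  forall x y, M (x *: g1 + y *: g2) <-> L x /\ K y.
Proof.
have /isomorphic_quotientP[phi [lphi kphi sphi]] := decomposition_iso D.
pose Q j := (quotient_module (ideal_exp (P j) (n j)) *
             quotient_module (ideal_exp (P j) (k j)))%type.
have [g1 e1] := sphi ((fun j => (quotient_class _ 1, 0) : Q j) : direct_sum _).
have [g2 e2] := sphi ((fun j => (0, quotient_class _ 1) : Q j) : direct_sum _).
have phiE x y j : phi (x *: g1 + y *: g2) j =
    (quotient_class _ (x : R^o), quotient_class _ (y : R^o)) :> Q j.
  have -> : phi (x *: g1 + y *: g2) = x *: phi g1 + y *: phi g2.
    by rewrite lphi -[y *: g2]addr0 lphi (kphi 0).2 ?addr0 //; exact: submod0.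
  rewrite e1 e2; congr pair; rewrite /= scaler0 ?addr0 ?add0r.
    by rewrite [RHS]quotient_class_scale1.
  by rewrite [RHS]quotient_class_scale1.
exists g1, g2; split=> [u|x y].
  have hu j : exists xy : R * R,
      phi u j = (quotient_class _ (xy.1 : R^o), quotient_class _ (xy.2 : R^o)) :> Q j.
    by exists (quotient_repr (phi u j).1, quotient_repr (phi u j).2);
      rewrite !quotient_reprK; case: (phi u j).
  have [c hc] := choice hu.
  have [x hx] := ideal_chinese_remainder (decomposition_coprime n) (fun j => (c j).1).
  have [y hy] := ideal_chinese_remainder (decomposition_coprime k) (fun j => (c j).2).
  exists x, y; apply/(linear_kernelP lphi kphi)/functional_extensionality_dep => j.
  rewrite phiE hc; congr pair; apply/quotient_classP; rewrite -opprB; exact: submodN.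
rewrite -kphi !decomposition_prodP; split=> [e|[hx hy]].
  have e' j : (quotient_class _ (x : R^o), quotient_class _ (y : R^o)) = 0 :> Q j.
    by rewrite -phiE e.
  by split=> j; apply/quotient_class_eq0; case: (e' j).
apply: functional_extensionality_dep => j; rewrite phiE.
by rewrite (quotient_class_eq0 _ _).2 // (quotient_class_eq0 _ _).2.
Qed.

(** [x *: g2] lies in [M] only for [x] in [K]; conversely [K] lies in [L] and so kills both
    generators. *)
Lemma decomposition_annihilator x : K x <-> forall u, M (x *: u).
Proof.
have [g1 [g2 [hg hM]]] := decomposition_generators; split=> [Kx u|h]; last first.
  have /hM[] : M (0 *: g1 + x *: g2) by rewrite scale0r add0r; exact: h.
  by [].
have [y [z /(submodZ x) h]] := hg u; rewrite -[u](subrK (y *: g1 + z *: g2)) scalerDr.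
apply: submodD => //; rewrite scalerDr !scalerA; apply/hM.
by split; [apply: mem_idealMr; exact: decomposition_sub|exact: mem_idealMr].
Qed.

(* This lemma and the next say that [L] is generated by the coordinates of the elements of [M]:
   modulo [L], and modulo any ideal containing these coordinates, the matrix of [(g1, g2)] in the
   standard basis is invertible. *)
Lemma decomposition_coordinates m : M m -> L m.1 /\ L m.2.
Proof.
have [g1 [g2 [hg hM]]] := decomposition_generators => Mm.
have [x1 [y1 h1]] := hg (1, 0); have [x2 [y2 h2]] := hg (0, 1).
(* Linear choice of coordinates of [u] with respect to [g1], [g2] modulo [M]. *)
pose A (u : plane R) := u.1 * x1 + u.2 * x2; pose B (u : plane R) := u.1 * y1 + u.2 * y2.
have AB u : M (u - (A u *: g1 + B u *: g2)).
  have -> : u - (A u *: g1 + B u *: g2) =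
      u.1 *: ((1, 0) - (x1 *: g1 + y1 *: g2)) + u.2 *: ((0, 1) - (x2 *: g1 + y2 *: g2)).
    by rewrite /A /B; case: u g1 g2 {hg hM h1 h2} => [u1 u2] [a b] [c d]; congr pair;
      do 2!rewrite /GRing.scale /=; ring.
  by apply: submodD; exact: submodZ.
have /hM[LA KB] : M (A m *: g1 + B m *: g2).
  by rewrite -[X in M X](subKr m); apply: submodB.
have {KB}LB := decomposition_sub KB.
have /hM[hp /decomposition_sub hq] : M ((1 - A g1) *: g1 + (- B g1) *: g2).
  by have := AB g1; rewrite scalerBl scale1r scaleNr opprD addrA.
have /hM[hr /decomposition_sub hs] : M ((- A g2) *: g1 + (1 - B g2) *: g2).
  by have := AB g2; rewrite scalerBl scale1r scaleNr opprD addrCA.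
(* The coordinates of [g1], [g2] themselves form the identity matrix modulo [L]. That matrix is the
   product of the matrix of [(g1, g2)] with the one formed by the [x] and [y], so the determinant of
   the latter is a unit modulo [L]. *)
have hD z : L (z * (x1 * y2 - x2 * y1)) -> L z.
  move=> h; apply: (ideal_det_unit (r := A g2) hp hs hq).
  have -> : z * (A g1 * B g2 - B g1 * A g2) =
      (g1.1 * g2.2 - g1.2 * g2.1) * (z * (x1 * y2 - x2 * y1)) by rewrite /A /B; ring.
  exact: mem_idealM.
(* Cramer's rule: [A m] and [B m] lie in [L], hence so do the entries of [m] times the
   determinant. *)
split; apply: hD.
  have -> : m.1 * (x1 * y2 - x2 * y1) = y2 * A m - x2 * B m by rewrite /A /B; ring.
  by apply: (@submodB _ R^o); exact: mem_idealM.
have -> : m.2 * (x1 * y2 - x2 * y1) = x1 * B m - y1 * A m by rewrite /A /B; ring.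
by apply: (@submodB _ R^o); exact: mem_idealM.
Qed.

Lemma decomposition_coordinates_min (J : ideal R) :
  (forall m, M m -> J m.1 /\ J m.2) -> L `<=` J.
Proof.
have [g1 [g2 [hg hM]]] := decomposition_generators => hJ z Lz.
have [x1 [y1 /hJ[/= hp hq]]] := hg (1, 0); have [x2 [y2 /hJ[/= hr hs]]] := hg (0, 1).
rewrite sub0r in hq; apply: (ideal_det_unit (r := x2 * g1.1 + y2 * g2.1) hp hs hq).
have [|/= Jz1 Jz2] := hJ (z *: g1).
  have /hM : L z /\ K 0 by split=> //; exact: (@submod0 _ R^o).
  by rewrite scale0r addr0.
rewrite /GRing.scale /= in Jz1 Jz2 *.
(* Multiplicativity of the determinant: [z] times that of [(g1, g2)] is in [J], because both entries
   of [z *: g1] are. *)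
set X := (X in J X); have -> : X = (x1 * y2 - x2 * y1) * (g2.2 * (z * g1.1) - g2.1 * (z * g1.2)).
  by rewrite /X; ring.
by apply: mem_idealM; apply: (@submodB _ R^o); exact: mem_idealM.
Qed.

Lemma decomposition_mul_block j :
  ideal_mul L (P j) = ideal_prod (fun i => ideal_exp (P i) (n i + (i == j))).
Proof.
rewrite /ideal_prod; under [RHS]eq_bigr do rewrite ideal_expD.
rewrite big_split /=; congr ideal_mul; rewrite (bigD1 j) //= eqxx ideal_exp1 big1 ?Monoid.mulm1 //.
by move=> i /negPf ->.
Qed.

(** Such a [t] has order exactly [n j] at each [P j]: one more power of [P j] would put it in all
    prime power factors of [L P_j]. *)
Lemma decomposition_notin_exp t : (L `\` \bigcup_j ideal_mul L (P j)) t ->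
  L t /\ forall j, ~ ideal_exp (P j) (n j).+1 t.
Proof.
move=> [Lt nt]; split=> // j Pt; apply: nt; exists j => //.
rewrite decomposition_mul_block; apply/decomposition_prodP => i.
have [->|_] := eqVneq i j; first by rewrite addn1.
by rewrite addn0; exact: (decomposition_prodP n t).1.
Qed.

(* The elements of [L] are multiples of [t0] modulo [K], and [(a, b)] is proportional to [(c, d)]
   modulo [I], where [K = L I]. *)
Lemma decomposition_line (hR : dedekind R) (a b c d t0 t : R) : unimodular c d ->
  (L `\` \bigcup_j ideal_mul L (P j)) t0 -> M (t0 * c, t0 * d) ->
  ideal_prod (fun j => ideal_exp (P j) (k j - n j)) (a * d - b * c) ->
  L t -> M (t * a, t * b).
Proof.
move=> /unimodular_bezout[x [y e]] /decomposition_notin_exp[Lt0 nt0] Mt0 Iab Lt.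
have hr j : exists s, ideal_exp (P j) (k j) (t - s * t0).
  apply: (ideal_exp_generator hR _ (decomposition_maximal D j) _ (nt0 j)).
    exact: (decomposition_prodP n t0).1.
  exact: (decomposition_prodP n t).1.
have [s hs] := choice hr.
have [s0 hs0] := ideal_chinese_remainder (decomposition_coprime k) s.
have Ks : K (t - s0 * t0).
  apply/decomposition_prodP => j.
  have -> : t - s0 * t0 = t - s j * t0 - (s0 - s j) * t0 by ring.
  by apply: (@submodB _ R^o) => //; exact: mem_idealMr.
have Kab : K (t * (a * d - b * c)).
  apply/decomposition_prodP => j; rewrite -(subnKC (decomposition_exponents D j).1) ideal_expD.
  by apply: mem_ideal_mul; [exact: (decomposition_prodP n t).1|];
    exact: (decomposition_prodP (fun i => k i - n i)%N _).1.
have Mtcd : M (t * c, t * d).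
  have -> : (t * c, t * d) =
      s0 *: ((t0 * c, t0 * d) : plane R) + (t - s0 * t0) *: ((c, d) : plane R).
    by congr pair; do 2!rewrite /GRing.scale /=; ring.
  by apply: submodD; [exact: submodZ|exact: (decomposition_annihilator _).1].
(* From [x c + y d = 1] follows [(a, b) = (x a + y b)(c, d) + (a d - b c)(y, -x)]; after scaling by
   [t], the last coefficient lies in [K], which annihilates the quotient. *)
have -> : (t * a, t * b) = 
      (x * a + y * b) *: ((t * c, t * d) : plane R) + (t * (a * d - b * c)) *: ((y, - x) : plane R).
  congr pair; do 2!rewrite /GRing.scale /=.
    by rewrite -{1}[t * a]mulr1 -e; ring.
  by rewrite -{1}[t * b]mulr1 -e; ring.
by apply: submodD; [exact: submodZ|exact: (decomposition_annihilator _).1].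
Qed.

End Decomposition.

(** Reconciles the decomposition witnessing the invariant factors with the possibly different one
    witnessing the projective invariant. *)
Lemma invariant_decomposition_unique (R : idomainType) (M : submodule (plane R))
    r (P : 'I_r -> ideal R) n k r' (P' : 'I_r' -> ideal R) n' k' :
  invariant_decomposition M P n k -> invariant_decomposition M P' n' k' ->
  ideal_prod (fun j => ideal_exp (P j) (n j)) = ideal_prod (fun j => ideal_exp (P' j) (n' j)) /\
  ideal_prod (fun j => ideal_exp (P j) (k j)) = ideal_prod (fun j => ideal_exp (P' j) (k' j)).
Proof.
move=> D D'; split; last first.
  apply: submod_eq => x; rewrite (decomposition_annihilator D).
  by rewrite (decomposition_annihilator D').
apply: submodule_ext; apply/seteqP; split.
  exact/(decomposition_coordinates_min D)/(decomposition_coordinates D').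
exact/(decomposition_coordinates_min D')/(decomposition_coordinates D).
Qed.

(** * Co-torsion submodules and their rank *)

Section Cotorsion.
Variable R : idomainType.
Implicit Type M : submodule (plane R).

Lemma cotorsionP M : cotorsion M <-> forall u, exists2 r : R, r != 0 & M (r *: u).
Proof.
have scaleE (r : R) u : r *: quotient_class M u = 0 <-> M (r *: u).
  have -> : r *: quotient_class M u = quotient_class M (r *: u) by rewrite quotient_classZ.
  exact: quotient_class_eq0.
split=> [h u|h x]; first by have [r r0 /scaleE] := h (quotient_class M u); exists r.
have [r r0 /scaleE e] := h (quotient_repr x).
by exists r; rewrite // -[x]quotient_reprK.
Qed.

Lemma cotorsion_bigcap l (M : 'I_l -> submodule (plane R)) :
  (forall i, cotorsion (M i)) -> cotorsion (submodule_bigcap M).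
Proof.
move=> cM; apply/cotorsionP => u.
have /choice[c hc] i : exists r : R, r != 0 /\ M i (r *: u).
  by have /cotorsionP/(_ u)[r r0 Mr] := cM i; exists r.
exists (\prod_i c i); first by apply/prodf_neq0 => i _; exact: (hc i).1.
move=> i _; change (M i ((\prod_j c j) *: u)).
by rewrite (bigD1 i) //= mulrC -scalerA; apply: submodZ; exact: (hc i).2.
Qed.

(** Nonzero multiples [u], [v] of the two basis vectors lie in [M]. They are independent, and every
    further vector depends on them. *)
Lemma cotorsion_has_rank2 M : cotorsion M -> has_rank M 2.
Proof.
move=> /cotorsionP cM.
have [r r0 Mr] := cM (1, 0); have [s s0 Ms] := cM (0, 1).
set u := _ *: _ in Mr; set v := _ *: _ in Ms.
have uv (a b : R) : a *: u + b *: v = (a * r, b * s).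
  by rewrite /u /v; congr pair; do 2!rewrite /GRing.scale /=; ring.
have uNv : u != v.
  apply/eqP => /(congr1 fst); rewrite /u /v /GRing.scale /= /GRing.scale /= mulr1 mulr0.
  by apply/eqP.
exists [set u; v]; last first.
  pose f (i : nat) := if i == 0%N then u else v.
  have -> : [set u; v] = f @` `I_2.
    apply/seteqP; split=> [w [->|->]|_ [[|i] _ <-]]; [by exists 0%N|by exists 1%N|by left|by right].
  apply: inj_card_eq => -[|[|i]] [|[|j]] //; rewrite ?inE //= /f /= => _ _ /eqP.
    by rewrite (negPf uNv).
  by rewrite eq_sym (negPf uNv).
split.
- by move=> w [->|->].
- move=> t c ut tuv e0.
  have proj (f : {linear plane R -> R^o}) x y : [set u; v] = [set x; y] -> f x != 0 -> f y = 0 ->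
      x \in t -> c x = 0.
    move=> exy fx0 fy0 xt; have := congr1 f e0; rewrite linear0 linear_sum (bigD1_seq x) //=.
    rewrite big_seq_cond big1 => [|w /andP[wt /eqP nwx]].
      by rewrite addr0 linearZ => /eqP; rewrite mulf_eq0 (negPf fx0) orbF => /eqP.
    have := tuv w wt; rewrite exy linearZ => -[/nwx//|->].
    by rewrite fy0; exact: mulr0.
  move=> w wt; have [eu|ev] := tuv w wt.
    rewrite eu in wt *; apply: (proj fst u v) => //.
      by rewrite /= /GRing.scale /= mulr1.
    by rewrite /= /GRing.scale /= mulr0.
  rewrite ev in wt *; apply: (proj snd v u) => //; first by rewrite setUC.
    by rewrite /= /GRing.scale /= mulr1.
  by rewrite /= /GRing.scale /= mulr0.
- move=> T TM Tind uvT; apply/seteqP; split=> // w Tw; apply: contrapT => nw.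
  have nu : u != w by apply/eqP => e; apply: nw; left.
  have nv : v != w by apply/eqP => e; apply: nw; right.
  (* Coefficients of the relation [s w_1 u + r w_2 v - r s w = 0]. *)
  pose c (x : plane R) := if x == u then s * w.1 else if x == v then r * w.2 else - (r * s).
  suff : c w = 0.
    rewrite /c ![w == _]eq_sym (negPf nu) (negPf nv) => /eqP.
    by rewrite oppr_eq0 mulf_eq0 (negPf r0) (negPf s0).
  apply: (Tind [:: u; v; w] c); last by rewrite !inE eqxx !orbT.
  - by rewrite /= !inE negb_or nu nv uNv.
  - by move=> x; rewrite !inE => /or3P[] /eqP ->; [apply: uvT; left|apply: uvT; right|].
  - rewrite !big_cons big_nil addr0 /c eqxx [v == u]eq_sym (negPf uNv) eqxx.
    rewrite ![w == _]eq_sym (negPf nu) (negPf nv) addrA uv.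
    by case: w {Tw nw nu nv c} => [w1 w2]; congr pair; do 2!rewrite /GRing.scale /=; ring.
Qed.
End Cotorsion.

(** * Intersections *)

(** Moves a tuple of the direct sum from ordinals to pairs (submodule, prime). The component type
    depends on the index, so the value at [g t] is transported along [gK t]. *)
Lemma dependent_reindex (S T : Type) (X : T -> Type) (f : S -> T) (g : T -> S) :
  cancel f g -> cancel g f -> forall h : (forall s, X (f s)),
  exists h' : (forall t, X t), forall s, h' (f s) = h s.
Proof.
move=> fK gK h; exists (fun t => ecast t (X t) (gK t) (h (g t))) => s.
have : g (f s) = s by []; move: (gK (f s)).
generalize (g (f s)) => s' e es; subst s'.
by rewrite (Prop_irrelevance e erefl).
Qed.

Section Intersection.
Variables (R : idomainType) (l : nat) (M : 'I_l -> submodule (plane R)).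
Variables (r : 'I_l -> nat) (P : forall i, 'I_(r i) -> ideal R).
Variables (n k : forall i, 'I_(r i) -> nat).
Arguments P {i}.
Arguments n {i}.
Arguments k {i}.
Hypothesis D : forall i, invariant_decomposition (M i) (@P i) (@n i) (@k i).
Hypothesis coK : forall i i', i != i' ->
  coprime_ideals (ideal_prod (fun j : 'I_(r i) => ideal_exp (P j) (k j)))
                 (ideal_prod (fun j : 'I_(r i') => ideal_exp (P j) (k j))).

(** The primes of all the [M i] together, enumerated by [blk] since a decomposition is indexed by
    ordinals. *)
Let T : finType := {i : 'I_l & 'I_(r i)}.
Let blk (s : 'I_#|T|) : T := enum_val s.

Lemma ideal_prod_blocks (F : forall i, 'I_(r i) -> ideal R) :
  ideal_prod (fun s => F (tag (blk s)) (tagged (blk s))) =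
  ideal_prod (fun i => ideal_prod (F i)).
Proof.
rewrite /ideal_prod sig_big_dep /= (reindex blk) //=.
exact: (onW_bij _ (enum_val_bij T)).
Qed.

(** The decompositions are concatenated. A prime shared by two of the submodules would contain both
    annihilators, which are coprime; so the primes stay distinct. *)
Lemma bigcap_decomposition : invariant_decomposition (submodule_bigcap M)
  (fun s => P (tagged (blk s))) (fun s => n (tagged (blk s))) (fun s => k (tagged (blk s))).
Proof.
split=> [s|s s' eP|s|].
- exact: (decomposition_maximal (D _)).
- apply: enum_val_inj; rewrite -!/(blk _); case: (blk s) (blk s') eP => [i j] [i' j'] /= eP.
  have [ei|/coK[x [y [/ideal_big_sub Px /ideal_big_sub Py e]]]] := eqVneq i i'.
    by move: j' eP; rewrite -ei => j' /(decomposition_distinct (D i)) ->.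
  case: (maximal_ideal_proper (decomposition_maximal (D i) j)); rewrite -e.
  apply: (@submodD _ R^o); first exact: ideal_exp_sub1 (decomposition_exponents (D i) j).2 _ (Px j).
  by rewrite eP; apply: ideal_exp_sub1 (decomposition_exponents (D i') j').2 _ (Py j').
- exact: (decomposition_exponents (D _)).
have /(_ _)/isomorphic_quotientP hphi i := decomposition_iso (D i).
pose phi i := sval (cid (hphi i)).
have lphi i : linear (phi i) by rewrite /phi; case: cid => ? [].
have kphi i u : phi i u = 0 <-> M i u by rewrite /phi; case: cid => ? [].
have sphi i w : exists u, phi i u = w by rewrite /phi; case: cid => ? [].
pose X (t : T) : lmodType R := (quotient_module (ideal_exp (P (tagged t)) (n (tagged t))) *
  quotient_module (ideal_exp (P (tagged t)) (k (tagged t))))%type.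
apply/isomorphic_quotientP.
exists (fun u s => phi (tag (blk s)) u (tagged (blk s))); split.
- move=> a u v; apply: functional_extensionality_dep => s.
  by rewrite lphi.
- move=> u; split=> [e i _|Mu]; last first.
    apply: functional_extensionality_dep => s.
    by rewrite (kphi _ _).2 //; exact: Mu.
  have e' (t : T) : (phi (tag t) u : direct_sum (fun j => X (existT _ (tag t) j))) (tagged t) = 0
      :> X (existT _ (tag t) (tagged t)).
    by rewrite -[t]enum_rankK; exact: (congr1 (fun h => h (enum_rank t)) e).
  apply/kphi; apply: functional_extensionality_dep => j.
  exact: (e' (existT _ i j)).
move=> h.
have [h' hh'] := @dependent_reindex _ T X blk enum_rank enum_valK enum_rankK h.
have /choice[w hw] i : exists u, phi i u = (fun j => h' (existT _ i j)) by exact: sphi.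
(* Surjectivity: the preimages [w i] are glued modulo the [M i], which is possible because the
   [i]-th annihilator maps the plane into [M i]. *)
have [u hu] := ideal_chinese_lift coK w.
exists u; apply: functional_extensionality_dep => s; rewrite -hh'.
have -> : phi (tag (blk s)) u = phi (tag (blk s)) (w (tag (blk s))).
  by apply/(linear_kernelP (lphi _) (kphi _))/hu => x v Kx;
    exact: (decomposition_annihilator (D _) _).1.
by rewrite hw; case: (blk s).
Qed.

End Intersection.

(** Packs [r], [P], [n], [k] into one type, so that a decomposition can be chosen for all [i] at
    once. *)
Definition factor_data (R : idomainType) :=
  {r : nat & (('I_r -> ideal R) * (('I_r -> nat) * ('I_r -> nat)))%type}.

Theorem theorem5p3 (R : idomainType) (hR : dedekind R)
    (F : set (ideal R)) (hFfin : finite_set F)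
    (hFmax : forall P : ideal R, F P -> maximal_ideal P)
    (l : nat) (M : 'I_l -> submodule (plane R))
    (hMcot : forall i, cotorsion (M i))
    (hMrank : forall i, has_rank (M i) 2)
    (L K : 'I_l -> ideal R)
    (hLK : forall i, invariant_factors (M i) (L i) (K i))
    (hKcop : forall i j, i != j -> ideal_add (K i) (K j) = ideal_full R)
    (I : 'I_l -> ideal R)
    (hI : forall i, K i = ideal_mul (L i) (I i))
    (hKF : forall P : ideal R, maximal_ideal P ->
       (exists i, K i `<=` P) -> F P)
    (a_ b_ : 'I_l -> R) (hab_ : forall i, unimodular (a_ i) (b_ i))
    (hinv : forall i, projective_invariant (M i) (pf_class (I i) (hab_ i)))
    (a b : R) (hab : unimodular a b)
    (heq : forall i, pf_class (I i) hab = pf_class (I i) (hab_ i)) :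
  [/\ cotorsion (submodule_bigcap M) /\ has_rank (submodule_bigcap M) 2,
      invariant_factors (submodule_bigcap M) (ideal_prod L) (ideal_prod K) /\
        ideal_prod K `<=` ideal_prod L,
      projective_invariant (submodule_bigcap M)
        (pf_class (ideal_prod I) hab) &
      forall t : R,
        (ideal_prod L `\` \bigcup_(P in F) ideal_mul (ideal_prod L) P) t ->
        submodule_bigcap M (t * a, t * b)].
Proof.
pose Pd (d : factor_data R) : 'I_(tag d) -> ideal R := (tagged d).1.
pose nd (d : factor_data R) : 'I_(tag d) -> nat := (tagged d).2.1.
pose kd (d : factor_data R) : 'I_(tag d) -> nat := (tagged d).2.2.
pose dec i d := invariant_decomposition (M i) (Pd d) (nd d) (kd d).
pose Ld d := ideal_prod (fun j => ideal_exp (Pd d j) (nd d j)).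
pose Kd d := ideal_prod (fun j => ideal_exp (Pd d j) (kd d j)).
have /choice[d hd] i : exists d, [/\ dec i d, L i = Ld d & K i = Kd d].
  by have [r [P [n [k [D eL eK]]]]] := hLK i; exists (existT _ r (P, (n, k))).
(* The equality of [[a:b]] with the invariant of [M i] is used here to compare [(a, b)] directly
   with the witness pair [(x, y)]. *)
have /choice[d' hd'] i : exists d, [/\ dec i d,
    I i = ideal_prod (fun j => ideal_exp (Pd d j) (kd d j - nd d j)) &
    exists x y t, [/\ unimodular x y, (Ld d `\` \bigcup_j ideal_mul (Ld d) (Pd d j)) t,
      M i (t * x, t * y) & I i (a * y - b * x)]].
  have [r [P [n [k [D eI [x [y [hxy [t [ht Mt e]]]]]]]]]] := hinv i.
  exists (existT _ r (P, (n, k))); split=> //; exists x, y, t; split=> //.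
  by apply/(pf_classP (I i) hab hxy); rewrite heq.
have hD i : dec i (d i) by case: (hd i).
have hD' i : dec i (d' i) by case: (hd' i).
have eL i : L i = Ld (d i) by case: (hd i).
have eK i : K i = Kd (d i) by case: (hd i).
have eL' i : L i = Ld (d' i) by rewrite eL;
  exact: (invariant_decomposition_unique (hD i) (hD' i)).1.
have eK' i : K i = Kd (d' i) by rewrite eK;
  exact: (invariant_decomposition_unique (hD i) (hD' i)).2.
have coK i j : i != j -> coprime_ideals (K i) (K j) by move=> /hKcop/ideal_add_full.
have coKd i j : i != j -> coprime_ideals (Kd (d i)) (Kd (d j)) by rewrite -!eK; exact: coK.
have coKd' i j : i != j -> coprime_ideals (Kd (d' i)) (Kd (d' j)) by rewrite -!eK'; exact: coK.
(* Serves both the fourth claim and the witness [t] of the third. *)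
have Mab t : ideal_prod L t -> submodule_bigcap M (t * a, t * b).
  move=> Lt i _; have [_ eI [x [y [t0 [hxy ht0 Mt0 Iab]]]]] := hd' i.
  apply: (decomposition_line (hD' i) hR hxy ht0 Mt0); first by rewrite -eI.
  by rewrite -/(Ld _) -eL'; exact: (@ideal_big_sub _ _ L i) Lt.
have cM := cotorsion_bigcap hMcot.
split; last by move=> t [/Mab].
- by split=> //; exact: cotorsion_has_rank2.
- have D := bigcap_decomposition hD coKd; split; last first.
    by apply: ideal_bigS => i _; rewrite eL eK; exact: (decomposition_sub (hD i)).
  do 4!eexists; split; first exact: D.
    rewrite (ideal_prod_blocks (fun i j => ideal_exp (Pd (d i) j) (nd (d i) j))).
    by congr ideal_prod; apply/funext => i.
  rewrite (ideal_prod_blocks (fun i j => ideal_exp (Pd (d i) j) (kd (d i) j))).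
  by congr ideal_prod; apply/funext => i.
have D := bigcap_decomposition hD' coKd'.
pose T : finType := {i : 'I_l & 'I_(tag (d' i))}.
pose i_ (s : 'I_#|T|) := tag (enum_val s).
pose Pc s := Pd (d' (i_ s)) (tagged (enum_val s)).
pose nc s := nd (d' (i_ s)) (tagged (enum_val s)).
have eLD : ideal_prod (fun s => ideal_exp (Pc s) (nc s)) = ideal_prod L.
  rewrite (ideal_prod_blocks (fun i j => ideal_exp (Pd (d' i) j) (nd (d' i) j))).
  by congr ideal_prod; apply/funext => i.
do 4!eexists; split; first exact: D.
  rewrite (ideal_prod_blocks (fun i j => ideal_exp (Pd (d' i) j) (kd (d' i) j - nd (d' i) j))).
  by congr ideal_prod; apply/funext => i; case: (hd' i).
have /choice[t0 ht0] i : exists t, (Ld (d' i) `\` \bigcup_j ideal_mul (Ld (d' i)) (Pd (d' i) j)) t.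
  by have [_ _ [x [y [t [_ ht _ _]]]]] := hd' i; exists t.
(* Congruence to the witness of the relevant [M i] modulo [P^(n+1)] preserves order exactly [n] at
   each prime, so [t] lies in [L] but in no [L P]. *)
have [t ht] := ideal_chinese_remainder (decomposition_coprime D (fun s => (nc s).+1))
  (fun s => t0 (i_ s)).
have [Pt nPt] : (forall s, ideal_exp (Pc s) (nc s) t) /\ forall s, ~ ideal_exp (Pc s) (nc s).+1 t.
  split=> s; have [L0 nL0] := decomposition_notin_exp (hD' _) (ht0 (i_ s)).
    rewrite -[t](subrK (t0 (i_ s))); apply: (@submodD _ R^o).
      exact: (ideal_exp_sub (leqnSn _)) (ht s).
    exact: (decomposition_prodP (hD' _) _ _).1.
  move=> Pt; apply: (nL0 (tagged (enum_val s))); rewrite -[t0 _](subKr t).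
  by apply: (@submodB _ R^o) => //; exact: ht.
exists a, b, hab, t; split=> //; last first.
  by apply: Mab; rewrite -eLD; exact/(decomposition_prodP D).
split; first exact/(decomposition_prodP D).
move=> [s _]; rewrite (decomposition_mul_block _ _ s) => /(decomposition_prodP D)/(_ s).
by rewrite eqxx addn1; exact: nPt.
Qed.
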